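(* Fix $\alpha\in\Theta$. The influence function at $P_{\theta_0}$ of the functional $U_\alpha(P)=\int m(T_\alpha(P),\alpha,y)\,dP(y)$, where $T_\alpha(P)=\arg\sup_{\theta\in\Theta}\int m(\theta,\alpha,y)\,dP(y)$ (the functional corresponding to the dual estimator of the divergence $\phi(\alpha,\theta_0)$), is given by $$\mathrm{IF}(x;U_\alpha,P_{\theta_0})=-\phi(\alpha,\theta_0)+m(\theta_0,\alpha,x).$$
   Context: Setting: $\varphi:(0,\infty)\to[0,\infty]$ is a non-negative, strictly convex, differentiable function with $\varphi(1)=0$, extended by $\varphi(0)=\lim_{x\downarrow 0}\varphi(x)$. $\{P_\theta:\theta\in\Theta\}$, $\Theta\subset\mathbb R^d$, is an identifiable parametric model on a measurable space $(\mathcal X,\mathcal B)$; each $P_\theta$ has density $p_\theta$ with respect to a dominating $\sigma$-finite measure $\lambda$; $\theta_0\in\Theta$ is the true parameter value. Put $\phi(\alpha,\theta)=\int\varphi(p_\alpha/p_\theta)\,dP_\theta$ and $$m(\theta,\alpha,x)=\int\varphi'\left(\frac{p_\alpha}{p_\theta}\right)dP_\alpha-\left\{\varphi'\left(\frac{p_\alpha(x)}{p_\theta(x)}\right)\frac{p_\alpha(x)}{p_\theta(x)}-\varphi\left(\frac{p_\alpha(x)}{p_\theta(x)}\right)\right\},$$ so that (dual representation) $\phi(\alpha,\theta_0)=\sup_{\theta\in\Theta}\int m(\theta,\alpha)\,dP_{\theta_0}$, the supremum being uniquely attained at $\theta=\theta_0$ for every $\alpha$. With $P_n$ the empirical measure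 of an i.i.d. sample, the divergence $\phi(\alpha,\theta_0)$ is estimated by $\widehat\phi_n(\alpha,\theta_0)=\sup_{\theta\in\Theta}\int m(\theta,\alpha)\,dP_n=U_\alpha(P_n)$. $m'(\theta,\alpha)$ and $m''(\theta,\alpha)$ denote the gradient and Hessian matrix of $m$ with respect to $\theta$. Standing assumptions: for each $\alpha$, $\theta\mapsto m(\theta,\alpha)$ is twice continuously differentiable; the matrix $\int m''(\theta_0,\alpha)\,dP_{\theta_0}$ exists and is invertible; and all partial derivatives of order 1 and 2 of $\theta\mapsto m(\theta,\alpha)$ are dominated on some neighborhoods of $\theta_0$ by $P_{\theta_0}$-integrable functions (which justifies interchanging differentiation in $\theta$ and integration). The influence function of a statistical functional $T$ at $P$ is $\mathrm{IF}(x;T,P)=\lim_{\varepsilon\to0}\frac{T(\widetilde P_{\varepsilon x})-T(P)}{\varepsilon}$, where $\widetilde P_{\varepsilon x}=(1-\varepsilon)P+\varepsilon\delta_x$ and $\delta_x$ is the Dirac measure at $x$.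
   Formalization: It is assumed in addition that T_α exists at the contaminated laws for small ε>0 and that T_α(P̃_{εx}) → θ_0 as ε → 0+; without this convergence the formula can fail. θ_0 is interior to Θ and the limit is taken from the right. *)

(* Defs.v *)
From HB Require Import structures.
From mathcomp Require Import all_boot all_order all_algebra.
From mathcomp Require Import all_classical all_reals all_analysis.

Set Implicit Arguments.
Unset Strict Implicit.
Unset Printing Implicit Defensive.
Import Order.TTheory GRing.Theory Num.Theory.
Import numFieldNormedType.Exports.

Local Open Scope classical_set_scope.
Local Open Scope ring_scope.

(* Only the values of phi on ]0, +oo[ matter. Differentiability makes them
   finite, hence the codomain R; only phi(0), see phi_ext, can be +oo. *)
Record divergence_generator (R : realType) (phi : R -> R) : Prop := {
  generator_ge0 : forall x, 0 < x -> 0 <= phi x;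
  generator_strictly_convex : forall x y t, 0 < x -> 0 < y -> x != y ->
    0 < t < 1 -> phi (t * x + (1 - t) * y) < t * phi x + (1 - t) * phi y;
  generator_derivable : forall x, 0 < x -> derivable phi x 1;
  generator_1 : phi 1 = 0 }.

Definition phi_ext (R : realType) (phi : R -> R) (t : R) : \bar R :=
  if 0 < t then (phi t)%:E else lim ((phi s)%:E @[s --> 0^'+]).

Section model.
Context (R : realType) (disp : measure_display) (X : measurableType disp)
  (d : nat).

Record identifiable_density_model (Theta : set 'rV[R]_d)
    (lambda : {sigma_finite_measure set X -> \bar R})
    (P : 'rV[R]_d -> probability X R) (p : 'rV[R]_d -> X -> R) : Prop := {
  density_measurable : forall theta, Theta theta ->
    measurable_fun [set: X] (p theta);
  density_ge0 : forall theta, Theta theta -> forall x, 0 <= p theta x;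
  densityE : forall theta, Theta theta -> forall A, measurable A ->
    P theta A = (\int[lambda]_(x in A) (p theta x)%:E)%E;
  identifiable : forall theta theta', Theta theta -> Theta theta' ->
    (forall A, measurable A -> P theta A = P theta' A) -> theta = theta' }.

Section dual.
Context (phi : R -> R) (P : 'rV[R]_d -> probability X R)
  (p : 'rV[R]_d -> X -> R).

Definition phi_divergence (alpha theta : 'rV[R]_d) : \bar R :=
  (\int[P theta]_x phi_ext phi (p alpha x / p theta x))%E.

(* Extended-real valued, since phi(0) may be +oo and the integral may diverge.
   At r = 0 the bracket is - phi(0), which is the limit of phi'(r) r - phi(r)
   as r tends to 0+. The quotient is 0 where p theta vanishes. *)
Definition dual_m (theta alpha : 'rV[R]_d) (x : X) : \bar R :=
  let r := p alpha x / p theta x in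
  (\int[P alpha]_y (derive1 phi (p alpha y / p theta y))%:E
   - ((derive1 phi r * r)%R%:E - phi_ext phi r))%E.

Definition mean_m (Q : probability X R) (alpha theta : 'rV[R]_d) : \bar R :=
  (\int[Q]_y dual_m theta alpha y)%E.

Definition dual_representation (Theta : set 'rV[R]_d)
    (theta0 alpha : 'rV[R]_d) : Prop :=
  let S := ereal_sup [set mean_m (P theta0) alpha theta | theta in Theta] in
  phi_divergence alpha theta0 = S /\
  forall theta, Theta theta ->
    (mean_m (P theta0) alpha theta = S <-> theta = theta0).

End dual.

Definition is_argsup (Theta : set 'rV[R]_d) (h : 'rV[R]_d -> \bar R)
    (theta : 'rV[R]_d) : Prop :=
  Theta theta /\ forall theta', Theta theta' -> (h theta' <= h theta)%E.

Definition partial (i : 'I_d) (f : 'rV[R]_d -> R) : 'rV[R]_d -> R :=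
  'D_(delta_mx 0 i) f.

Definition twice_continuously_differentiable (A : set 'rV[R]_d)
    (f : 'rV[R]_d -> R) : Prop :=
  forall theta, A theta ->
    [/\ differentiable f theta,
        forall i, differentiable (partial i f) theta &
        forall i j, {for theta, continuous (partial j (partial i f))}].

Definition hessian (f : 'rV[R]_d -> R) (theta : 'rV[R]_d) : 'M[R]_d :=
  \matrix_(i, j) partial j (partial i f) theta.

Definition locally_dominated (Q : probability X R) (theta0 : 'rV[R]_d)
    (g : 'rV[R]_d -> X -> R) : Prop :=
  exists2 H : X -> R, Q.-integrable [set: X] (EFin \o H) &
    exists2 V : set 'rV[R]_d, nbhs theta0 V &
      {ae Q, forall y, forall theta, V theta -> `|g theta y| <= H y}.

(* The regularity assumptions on a criterion m theta y. Derivatives are taken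
   at interior points of Theta. *)
Record regular_criterion (Theta : set 'rV[R]_d) (theta0 : 'rV[R]_d)
    (Q : probability X R) (m : 'rV[R]_d -> X -> \bar R) : Prop := {
  criterion_fin : forall theta, Theta theta -> forall y, m theta y \is a fin_num;
  criterion_C2 : forall y,
    twice_continuously_differentiable Theta° (fun theta => fine (m theta y));
  criterion_hessian_integrable : forall i j, Q.-integrable [set: X]
    (fun y => (hessian (fun theta => fine (m theta y)) theta0 i j)%:E);
  criterion_hessian_unit :
    (\matrix_(i, j) \int[Q]_y hessian (fun theta => fine (m theta y)) theta0 i j)
      \in unitmx;
  criterion_dominated1 : forall i, locally_dominated Q theta0
    (fun theta y => partial i (fun theta => fine (m theta y)) theta);
  criterion_dominated2 : forall i j, locally_dominated Q theta0
    (fun theta y => hessian (fun theta => fine (m theta y)) theta i j) }.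

End model.

(* (1 - eps) Q + eps \d_x if 0 <= eps <= 1, and Q for any other eps, so as to
   have a probability for every real eps. *)
Definition contamination (R : realType) (disp : measure_display)
    (X : measurableType disp) (Q : probability X R) (x : X) (eps : R) :
    set X -> \bar R := fun A =>
  if 0 <= eps <= 1 then ((1 - eps)%R%:E * Q A + eps%:E * \d_x A)%E else Q A.

Section contamination_probability.
Context (R : realType) (disp : measure_display) (X : measurableType disp)
  (Q : probability X R) (x : X) (eps : R).

Local Notation contam := (contamination Q x eps).

Let contam0 : contam set0 = 0%E.
Proof.
by rewrite /contamination; case: ifP => _; rewrite !measure0 ?mule0 ?adde0.
Qed.

Let contam_ge0 A : (0 <= contam A)%E.
Proof.
rewrite /contamination; case: ifP => [/andP[e0 e1]|_]; last exact: measure_ge0.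
by apply: adde_ge0; apply: mule_ge0 => //; rewrite lee_fin ?subr_ge0.
Qed.

Let contam_sigma_additive : semi_sigma_additive contam.
Proof.
case: (boolP (0 <= eps <= 1)) => [/[dup] e01 /andP[e0 e1]|/negbTE e01].
  have e1' : 0 <= 1 - eps by rewrite subr_ge0.
  have -> : contam = measure_add (mscale (NngNum e1') Q) (mscale (NngNum e0) \d_x).
    by apply/funext => A; rewrite measure_addE/= /mscale/= /contamination e01.
  exact: measure_semi_sigma_additive.
have -> : contam = Q by apply/funext => A; rewrite /contamination e01.
exact: measure_semi_sigma_additive.
Qed.

HB.instance Definition _ := isMeasure.Build _ _ _ contam
  contam0 contam_ge0 contam_sigma_additive.

Let contam_setT : contam [set: X] = 1%E.
Proof.
rewrite /contamination probability_setT; case: ifP => // _.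
by rewrite diracT !mule1 -EFinD subrK.
Qed.

HB.instance Definition _ :=
  @Measure_isProbability.Build _ _ R contam contam_setT.

End contamination_probability.

(* eps tends to 0 from the right: the contaminated measure is a probability
   for 0 <= eps <= 1 only. *)
Definition has_influence_function (R : realType) (disp : measure_display)
    (X : measurableType disp) (T : probability X R -> \bar R)
    (Q : probability X R) (x : X) (l : \bar R) : Prop :=
  ((T (contamination Q x eps) - T Q) * (eps^-1)%:E)%E @[eps --> 0^'+] --> l.

(* Main.v *)
Require Import Defs.
From HB Require Import structures.
From mathcomp Require Import all_boot all_order all_algebra.
From mathcomp Require Import all_classical all_reals all_analysis.
From mathcomp Require Import measurable_realfun ring lra.
Import Order.TTheory GRing.Theory Num.Theory.
Import numFieldNormedType.Exports.
Local Open Scope classical_set_scope.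
Local Open Scope ring_scope.

(** The argument is an envelope argument: to first order, moving the maximiser
    of a criterion does not change its maximum.

    Write M theta for the mean of m theta under Q = P theta0, Q_e for
    (1 - e) Q + e \d_x, and theta_e for the maximiser under Q_e, so that the
    functional takes the value (1 - e) M theta_e + e m theta_e x at Q_e. Since
    theta_e maximises the mean under Q_e, this is at least
    (1 - e) M theta0 + e m theta0 x; since theta0 maximises M, it is at most
    (1 - e) M theta0 + e m theta_e x. Hence the difference quotient at e lies
    between m theta0 x - M theta0 and m theta_e x - M theta0, and both bounds
    have the limit m theta0 x - M theta0, because theta_e tends to theta0 and
    theta |-> m theta x is continuous at theta0. Unlike a Taylor expansion of
    the estimating equation, this needs no rate for theta_e.
    [influence_function_argsup] is this argument for an arbitrary criterion.
    The dual representation identifies theta0 as the maximiser of M, and M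
    theta0 as the divergence.

    Two points need care. The identity for the mean under Q_e,
    [integral_contamination], requires m theta to be measurable, hence phi' to
    be Borel on the positive half-line ([measurable_dual_m]). And M theta0 may
    be +oo: the difference quotient and the claimed limit are then both -oo.
    The value -oo is excluded because a divergence is nonnegative
    ([phi_ext_ge0]). *)

(** No integrability is assumed: f x being finite, the two point masses can be
    moved across the difference of the integrals of the positive and negative
    parts, whatever infinite values these take. *)
Lemma integral_contamination (R : realType) (disp : measure_display)
    (X : measurableType disp) (Q : probability X R) (x : X) (eps : R)
    (f : X -> \bar R) :
  0 <= eps <= 1 -> measurable_fun [set: X] f -> f x \is a fin_num ->
  (\int[contamination Q x eps]_y f y
   = (1 - eps)%:E * \int[Q]_y f y + eps%:E * f x)%E.
Proof.
move=> /[dup] eps01 /andP[eps0 eps1] mf fxfin.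
have eps1' : 0 <= 1 - eps by rewrite subr_ge0.
have contamE (g : X -> \bar R) : measurable_fun [set: X] g ->
    (forall y, 0 <= g y)%E ->
    (\int[contamination Q x eps]_y g y
     = (1 - eps)%:E * \int[Q]_y g y + eps%:E * g x)%E.
  move=> mg g0.
  pose mu := measure_add (mscale (NngNum eps1') Q)
               (mscale (NngNum eps0) \d_x).
  rewrite (eq_measure_integral mu) => [|A _ _]; last first.
    by rewrite [RHS]measure_addE /= /mscale /= /contamination eps01.
  rewrite ge0_integral_measure_add // !ge0_integral_mscale //.
  by rewrite integral_dirac // diracT mul1e.
have fxE : f x = (f^\+ x - f^\- x)%E by rewrite {1}[f]funeposneg.
rewrite integralE [in RHS]integralE [in RHS]fxE.
rewrite !contamE; [|exact: measurable_funeneg|exact: funeneg_ge0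
  |exact: measurable_funepos|exact: funepos_ge0].
have : (f^\+ x)%E \is a fin_num.
  by rewrite funeposE; case: (f x) fxfin => // r _; rewrite -EFin_max.
have : (f^\- x)%E \is a fin_num.
  by rewrite funenegE; case: (f x) fxfin => // r _; rewrite -EFin_max.
have : (0 <= \int[Q]_y f^\- y)%E.
  by apply: integral_ge0 => y _; exact: funeneg_ge0.
have : (0 <= \int[Q]_y f^\+ y)%E.
  by apply: integral_ge0 => y _; exact: funepos_ge0.
case: (f^\+ x)%E (f^\- x)%E => [a||] [b||] //.
case: (\int[Q]_y (f^\+ y))%E (\int[Q]_y (f^\- y))%E => [A||] [B||] // _ _ _ _.
- by rewrite /= -!EFinM -!EFinD; congr EFin; ring.
(* an infinite mean is annihilated when eps = 1, and kept otherwise *)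
all: case: (ltrgt0P (1 - eps)) eps1' => // [e_gt0 _|-> _].
all: rewrite ?mul0e ?add0e -?EFinM -?EFinD /= ?mulrBr //.
all: by rewrite ?(gt0_muley, gt0_muleNy) ?lte_fin //.
Qed.

(** The envelope argument. Maximality of T (Q_eps) under Q_eps bounds the
    difference quotient from below, that of theta0 under Q from above. *)
Lemma influence_function_argsup (R : realType) (disp : measure_display)
    (X : measurableType disp) (V : topologicalType) (Theta : set V)
    (m : V -> X -> \bar R) (theta0 : V) (Q : probability X R) (x : X)
    (T : probability X R -> V) :
  let argsup (Q' : probability X R) (theta : V) := Theta theta /\
    forall theta', Theta theta' ->
      (\int[Q']_y m theta' y <= \int[Q']_y m theta y)%E in
  (forall theta, Theta theta -> measurable_fun [set: X] (m theta)) ->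
  (forall theta, Theta theta -> m theta x \is a fin_num) ->
  {for theta0, continuous (fun theta => fine (m theta x))} ->
  (\int[Q]_y m theta0 y != -oo)%E ->
  argsup Q theta0 -> argsup Q (T Q) ->
  (\forall eps \near 0^'+,
    argsup (contamination Q x eps) (T (contamination Q x eps))) ->
  T (contamination Q x eps) @[eps --> 0^'+] --> theta0 ->
  has_influence_function (fun Q' => \int[Q']_y m (T Q') y)%E Q x
    (- (\int[Q]_y m theta0 y) + m theta0 x)%E.
Proof.
move=> argsup mm mfin mcont MNy argsup0 [TQ maxQ] maxC Tcvg.
have [T0 max0] := argsup0.
rewrite /has_influence_function.
have -> : (\int[Q]_y m (T Q) y = \int[Q]_y m theta0 y)%E.
  by apply/le_anti/andP; split; [exact: max0|exact: maxQ].
have near01 : \forall eps \near (0 : R)^'+, 0 < eps < 1.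
  near=> eps; apply/andP; split; near: eps; first exact: nbhs_right_gt.
  exact: nbhs_right_lt.
have -> : m theta0 x = (fine (m theta0 x))%:E by rewrite fineK // mfin.
case intE : (\int[Q]_y m theta0 y)%E MNy max0 => [s||] // _ max0; last first.
  (* the mean under Q is +oo, and adding -oo absorbs any value at Q_eps *)
  rewrite /=; apply: cvg_near_cst; near=> eps.
  have eps0 : 0 < eps by near: eps; exact: nbhs_right_gt.
  by rewrite addeNy gt0_mulNye // lte_fin invr_gt0.
rewrite -EFinN -EFinD.
pose h (eps : R) : R := - s + fine (m (T (contamination Q x eps)) x).
apply: (@squeeze_cvge _ _ _ _ (cst (- s + fine (m theta0 x))%:E) _
  (EFin \o h)); last first.
- suff hcvg : h eps @[eps --> 0^'+] --> (- s + fine (m theta0 x) : R).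
    by apply/fine_cvgP; split; [exact: nearW|exact: hcvg].
  apply: cvgD; first exact: cvg_cst.
  exact: (cvg_comp _ _ Tcvg mcont).
- exact: cvg_cst.
near=> eps.
have /andP[eps0 eps1] : 0 < eps < 1 by near: eps.
have eps01 : 0 <= eps <= 1 by rewrite !ltW.
have [Teps maxeps] : argsup (contamination Q x eps)
    (T (contamination Q x eps)).
  by near: eps.
(* writes both bounds as quotients, to compare the numerators only *)
have rescale (a : R) : ((- s + a)%:E
    = ((1 - eps)%:E * s%:E + eps%:E * a%:E - s%:E) * (eps^-1)%:E)%E.
  rewrite -!EFinM; congr EFin; field.
  by rewrite gt_eqF.
have epsV : (0 <= (eps^-1)%:E)%E by rewrite lee_fin invr_ge0 ltW.
rewrite /cst /= /h !rescale !fineK ?mfin //; apply/andP; split.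
all: apply: lee_wpmul2r => //; apply: leeD => //.
  apply: le_trans (maxeps _ T0).
  by rewrite integral_contamination ?intE //; [exact: mm|exact: mfin].
rewrite integral_contamination //; [|exact: mm|exact: mfin].
apply: leeD => //; apply: lee_wpmul2l; first by rewrite lee_fin subr_ge0 ltW.
exact: max0.
Unshelve. all: by end_near.
Qed.

(** At 0 the value is a limit, which exists because a convex function with
    minimum 0 at 1 is nonincreasing on ]0, 1]. *)
Lemma phi_ext_ge0 (R : realType) (phi : R -> R) (t : R) :
  divergence_generator phi -> (0 <= phi_ext phi t)%E.
Proof.
move=> phiP; rewrite /phi_ext; case: ifPn => [t0|_].
  by rewrite lee_fin (generator_ge0 phiP).
have phi_cvg : cvg ((phi s)%:E @[s --> 0^'+]).
  apply: nonincreasing_at_right_is_cvge; near=> b => s u sb ub su.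
  have b1 : b < 1 by near: b; exact: nbhs_right_lt.
  rewrite lee_fin; move: sb ub su.
  rewrite !in_itv /= => /andP[s0 sb] /andP[u0 ub].
  rewrite le_eqVlt => /predU1P[-> //|su].
  (* u lies between s and 1, where phi is at most c phi s + (1 - c) phi 1 *)
  pose c := (1 - u) / (1 - s).
  have s1 : 0 < 1 - s by lra.
  have c01 : 0 < c < 1.
    by rewrite divr_gt0 ?ltr_pdivrMr //=; lra.
  have -> : u = c * s + (1 - c) * 1 by rewrite /c; field; lra.
  have s_neq1 : s != 1 by lra.
  have := generator_strictly_convex phiP s0 ltr01 s_neq1 c01.
  rewrite (generator_1 phiP) mulr0 addr0 => /ltW /le_trans; apply.
  have := generator_ge0 phiP s0; move/andP: c01 => [? ?] ?; nra.
apply: lime_ge => //; near=> s.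
have s0 : 0 < s by near: s; exact: nbhs_right_gt.
by rewrite lee_fin (generator_ge0 phiP).
Unshelve. all: by end_near.
Qed.

Lemma measurable_generator (R : realType) (phi : R -> R) :
  divergence_generator phi -> measurable_fun (`]0, +oo[ : set R) phi.
Proof.
move=> phiP; apply: open_continuous_measurable_fun; first exact: interval_open.
move=> t; rewrite inE /= in_itv /= andbT => t0.
exact/differentiable_continuous/derivable1_diffP/(generator_derivable phiP).
Qed.

(** On the half-line phi' is the pointwise limit of the difference quotients of
    step 1/(n+1), which stay inside the half-line. *)
Lemma measurable_derive1_generator (R : realType) (phi : R -> R) :
  divergence_generator phi ->
  measurable_fun (`]0, +oo[ : set R) (derive1 phi).
Proof.
move=> phiP.
pose q (n : nat) (t : R) : R :=
  (n.+1%:R^-1)^-1 * (phi (n.+1%:R^-1 + t) - phi t).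
apply: (@measurable_fun_cvg _ _ _ _ q) => [n|t].
  rewrite /q; apply: measurable_funM => //.
  apply: measurable_funB; last exact: measurable_generator.
  apply: (measurable_comp (F := (`]0, +oo[ : set R))) => //; last first.
  - exact: measurable_funD.
  - exact: measurable_generator.
  - move=> _ [t + <-]; rewrite /= !in_itv /= !andbT => t0.
    by rewrite addr_gt0.
rewrite /= in_itv /= andbT => t0.
have dphi : h^-1 *: (phi (h + t) - phi t) @[h --> 0^'+] --> derive1 phi t.
  apply: cvg_dnbhs_at_right.
  have := generator_derivable phiP t0.
  rewrite /derivable (_ : (fun h : R => _) =
    (fun h : R => h^-1 *: (phi (h + t) - phi t))) //.
  by apply/funext => h; rewrite /= [h%:A]mulr1.
move/cvg_at_rightP : dphi; apply; split => //.
exact: cvg_harmonic.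
Qed.

(** phi is unconstrained on ]-oo, 0], so phi' may fail to be Borel there. The
    ratio r of the densities is nonnegative, so the bracket of dual_m factors
    through a function g that uses phi' on ]0, +oo[ only. *)
Lemma measurable_dual_m {R : realType} {disp : measure_display}
    {X : measurableType disp} {d : nat} {phi : R -> R} {Theta : set 'rV[R]_d}
    {lambda : {sigma_finite_measure set X -> \bar R}}
    {P : 'rV[R]_d -> probability X R} {p : 'rV[R]_d -> X -> R}
    {theta alpha : 'rV[R]_d} :
  divergence_generator phi -> identifiable_density_model Theta lambda P p ->
  Theta theta -> Theta alpha ->
  measurable_fun [set: X] (dual_m phi P p theta alpha).
Proof.
move=> phiP modelP thetaT alphaT.
have mp := density_measurable modelP thetaT.
have mpa := density_measurable modelP alphaT.
have p0 := density_ge0 modelP thetaT.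
have pa0 := density_ge0 modelP alphaT.
have mV : measurable_fun (`]0, +oo[ : set R) (@GRing.inv R).
  apply: open_continuous_measurable_fun; first exact: interval_open.
  move=> t; rewrite inE /= in_itv /= andbT => t0.
  by apply: inv_continuous; rewrite gt_eqF.
pose r y := p alpha y / p theta y.
have mr : measurable_fun [set: X] r.
  have -> : r = fun y =>
      if 0 < p theta y then p alpha y * (p theta y)^-1 else 0.
    apply/funext => y; rewrite /r; case: ifPn => //; rewrite -leNgt => py.
    have -> : p theta y = 0 by apply/le_anti; rewrite py p0.
    by rewrite invr0 mulr0.
  apply: measurable_fun_if => //; first exact: measurable_fun_ltr.
  apply: measurable_funM; first exact: measurable_funS mpa.
  apply: (measurable_comp (F := (`]0, +oo[ : set R))) => //; last first.
    exact: measurable_funS mp.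
  by move=> _ [y [_ +] <-]; rewrite /= in_itv /= andbT.
pose g (t : R) :=
  if 0 < t then (derive1 phi t * t - phi t)%:E else (- phi_ext phi 0)%E.
have mg : measurable_fun [set: R] g.
  apply: measurable_fun_if => //; first exact: measurable_fun_ltr.
  rewrite setTI; apply/measurable_EFinP.
  have -> : (fun t : R => 0 < t) @^-1` [set true] = `]0, +oo[%classic.
    by apply/seteqP; split => t /=; rewrite in_itv /= andbT.
  apply: measurable_funB; last exact: measurable_generator.
  by apply: measurable_funM => //; exact: measurable_derive1_generator.
have -> : dual_m phi P p theta alpha =
    ((fun=> \int[P alpha]_y (derive1 phi (p alpha y / p theta y))%:E)
     \- (g \o r))%E.
  apply/funext => y; rewrite /dual_m /= -/(r y) /g; congr (_ - _)%E.
  case: ifPn => [r0|]; first by rewrite /phi_ext r0.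
  rewrite -leNgt => r0; have -> : r y = 0.
    by apply/le_anti; rewrite r0 divr_ge0.
  by rewrite mulr0 add0e.
by apply: emeasurable_funB => //; exact: measurableT_comp.
Qed.

Theorem proposition2 (R : realType) (disp : measure_display)
    (X : measurableType disp) (d : nat)
    (phi : R -> R) (Theta : set 'rV[R]_d)
    (lambda : {sigma_finite_measure set X -> \bar R})
    (P : 'rV[R]_d -> probability X R) (p : 'rV[R]_d -> X -> R)
    (theta0 alpha : 'rV[R]_d) (x : X)
    (Talpha : probability X R -> 'rV[R]_d) :
  divergence_generator phi ->
  identifiable_density_model Theta lambda P p ->
  Theta° theta0 ->
  Theta alpha ->
  dual_representation phi P p Theta theta0 alpha ->
  regular_criterion Theta theta0 (P theta0)
    (fun theta y => dual_m phi P p theta alpha y) ->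
  is_argsup Theta (mean_m phi P p (P theta0) alpha) (Talpha (P theta0)) ->
  (\forall eps \near 0^'+,
    is_argsup Theta (mean_m phi P p (contamination (P theta0) x eps) alpha)
      (Talpha (contamination (P theta0) x eps))) ->
  Talpha (contamination (P theta0) x eps) @[eps --> 0^'+] --> theta0 ->
  has_influence_function
    (fun Q : probability X R => (\int[Q]_y dual_m phi P p (Talpha Q) alpha y)%E)
    (P theta0) x
    (- phi_divergence phi P p alpha theta0 + dual_m phi P p theta0 alpha x)%E.
Proof.
move=> phiP modelP intT alphaT [divE sup_uniq] regP argQ argC Tcvg.
have thetaT : Theta theta0 := interior_subset intT.
have meanE : mean_m phi P p (P theta0) alpha theta0
    = phi_divergence phi P p alpha theta0.
  by rewrite divE; apply/(sup_uniq _ thetaT).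
rewrite -meanE; apply: influence_function_argsup argQ argC Tcvg => //.
- by move=> theta ?; exact: (measurable_dual_m phiP modelP).
- by move=> theta /(criterion_fin regP).
- by have [/differentiable_continuous ? _ _] := criterion_C2 regP x intT.
- rewrite -[X in X != _]/(mean_m phi P p (P theta0) alpha theta0) meanE.
  rewrite -ltNye; apply: lt_le_trans (ltNyr 0) _.
  by apply: integral_ge0 => y _; exact: phi_ext_ge0.
- split=> // theta thetaT'.
  rewrite -[X in (_ <= X)%E]/(mean_m phi P p (P theta0) alpha theta0).
  by rewrite meanE divE; apply: ereal_sup_ubound; exists theta.
Qed.
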